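(* Let $F$ be a field of characteristic two and let $(A,\sigma)$ be a central simple $F$-algebra with orthogonal involution. If $K/F$ is a separable field extension, then $S(A_K,\sigma_K)=S(A,\sigma)\otimes_F K$ (as subsets of $A_K=A\otimes_F K$), and $(S(A_K,\sigma_K),q_{\sigma_K})\simeq (S(A,\sigma),q_\sigma)_K$ as quadratic spaces over $K$.
   Context: An involution on a central simple $F$-algebra $A$ is an anti-automorphism $\sigma$ of $A$ of order two. It is of the first kind if $\sigma|_F=\mathrm{id}$. An involution of the first kind is symplectic if it becomes adjoint to an alternating bilinear form over a splitting field of $A$, and orthogonal otherwise. Put $\mathrm{Alt}(A,\sigma)=\{x-\sigma(x)\mid x\in A\}$; an involution $\sigma$ of the first kind is orthogonal (in characteristic two) if and only if $\mathrm{Alt}(A,\sigma)\cap F=\{0\}$. For $\sigma$ orthogonal, set $S(A,\sigma)=\{x\in A\mid \sigma(x)x\in F\oplus\mathrm{Alt}(A,\sigma)\}$. For $x\in S(A,\sigma)$ there is a unique $\alpha\in F$ with $\sigma(x)x+\alpha\in\mathrm{Alt}(A,\sigma)$, and one sets $q_\sigma(x)=\alpha$. It is known that $S(A,\sigma)$ is an $F$-subalgebra of $A$ and that $q_\sigma:S(A,\sigma)\to F$ is a totally singular quadratic form (i.e. $q_\sigma(x)=\mathfrak b(x,x)$ for some symmetric bilinear form $\mathfrak b$), called the alternator form of $(A,\sigma)$. For a field extension $K/F$, $A_K=A\otimes_F K$, $\sigma_K=\sigma\otimes\mathrm{id}_K$, and $(S(A,\sigma),q_\sigma)_K$ denotes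 the scalar extension of the quadratic space to $K$. A separable extension means a (not necessarily finite) algebraic extension in which every element has a separable minimal polynomial over the ground field. *)

(* Defs.v *)
From HB Require Import structures.
From mathcomp Require Import all_boot all_order all_algebra.
From mathcomp Require Import falgebra separable sesquilinear.
From mathcomp Require Import boolp classical_sets.

Set Implicit Arguments.
Unset Strict Implicit.
Unset Printing Implicit Defensive.

Import GRing.Theory.
Local Open Scope ring_scope.
Local Open Scope classical_set_scope.

(******************************************************************************)
(*   A field extension K/F, possibly of infinite degree, is given by a ring   *)
(* morphism phi : F -> K.  For a finite-dimensional F-space V, V (x)_F K is   *)
(* realised as the space of coordinate rows over K with respect to the basis  *)
(* vbasis {:V}; pure_tensor_universal below states that it is the tensor      *)
(* product.                                                                   *)
(******************************************************************************)

Definition scalext (F K : fieldType) (phi : {rmorphism F -> K})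
    (V : vectType F) : Type := 'rV[K]_(\dim {:V}).

HB.instance Definition _ (F K : fieldType) (phi : {rmorphism F -> K})
    (V : vectType F) := Vector.copy (scalext phi V) 'rV[K]_(\dim {:V}).

Definition polar_form (F : fieldType) (V : vectType F) (q : V -> F)
    (u v : V) : F := q (u + v) - q u - q v.

Definition quadratic_form (F : fieldType) (V : vectType F) (q : V -> F) : Prop :=
  [/\ forall c v, q (c *: v) = c ^+ 2 * q v,
      forall w, scalar (polar_form q w)
    & forall w, scalar (fun v => polar_form q v w)].

Lemma quadratic_form_sum (F : fieldType) (V : vectType F) (q : V -> F) n
    (u : 'I_n -> V) : quadratic_form q ->
  q (\sum_i u i) =
    \sum_i q (u i) +
    \sum_(i < n) \sum_(j < n | (i < j)%N) polar_form q (u i) (u j).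
Proof.
move=> [qZ bl br].
have br0 w : polar_form q 0 w = 0.
  by have := br w (-1) 0 0; rewrite scaler0 addr0 mulN1r addNr.
have brD x y w : polar_form q (x + y) w = polar_form q x w + polar_form q y w.
  by have := br w 1 x y; rewrite scale1r mul1r.
elim: n u => [|n IHn] u.
  by rewrite !big_ord0 addr0 -(scale0r (0 : V)) qZ expr0n mul0r.
have qD x y : q (x + y) = q x + q y + polar_form q x y.
  by rewrite /polar_form -[_ - _ - _]addrA -opprD [RHS]addrC subrK.
rewrite big_ord_recr qD IHn [in RHS]big_ord_recr /=.
rewrite [in X in _ = _ + X]big_ord_recr /=.
rewrite [X in _ = _ + (_ + X)]big1 ?addr0; last first.
  by move=> j; rewrite ltnNge -ltnS ltn_ord.
rewrite (big_morph (polar_form q ^~ (u ord_max)) (fun x y => brD x y _) (br0 _)).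
have -> : \sum_(i < n) \sum_(j < n.+1 | (widen_ord (leqnSn n) i < j)%N)
      polar_form q (u (widen_ord (leqnSn n) i)) (u j) =
    \sum_(i < n) \sum_(j < n | (i < j)%N)
      polar_form q (u (widen_ord (leqnSn n) i)) (u (widen_ord (leqnSn n) j))
    + \sum_(i < n) polar_form q (u (widen_ord (leqnSn n) i)) (u ord_max).
  rewrite -big_split; apply: eq_bigr => i _.
  by rewrite big_mkcond big_ord_recr /= ltn_ord -big_mkcond.
by rewrite addrA; congr (_ + _); rewrite addrAC.
Qed.

Section ScalarExtensionSpace.
Variables (F K : fieldType) (phi : {rmorphism F -> K}).

Definition pure_tensor (V : vectType F) (v : V) (k : K) : scalext phi V :=
  \row_i (phi (coord (vbasis {:V}) i v) * k).

(* f (x) id_K, for an F-linear f *)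
Definition scalext_map (V W : vectType F) (f : V -> W) (x : scalext phi V) :
    scalext phi W :=
  \sum_(i < \dim {:V}) pure_tensor (f (vbasis {:V})`_i) (x 0 i).

(* The quadratic form on V (x) K that restricts to q on V; its polar form is  *)
(* the K-bilinear extension of the polar form of q.                           *)
Definition scalext_quad (V : vectType F) (q : V -> F) (x : scalext phi V) : K :=
  let e i := (vbasis {:V})`_i in
  \sum_(i < \dim {:V}) x 0 i ^+ 2 * phi (q (e i)) +
  \sum_(i < \dim {:V}) \sum_(j < \dim {:V} | (i < j)%N)
     x 0 i * x 0 j * phi (polar_form q (e i) (e j)).

Lemma pure_tensorE (V : vectType F) (v : V) k i :
  pure_tensor v k 0 i = phi (coord (vbasis {:V}) i v) * k.
Proof. by rewrite mxE. Qed.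

Lemma coord_e (V : vectType F) (i j : 'I_(\dim {:V})) :
  coord (vbasis {:V}) i (vbasis {:V})`_j = (i == j)%:R.
Proof. by rewrite coord_free ?(basis_free (vbasisP _)) 1?eq_sym. Qed.

Lemma pure_tensorDl (V : vectType F) k :
  {morph (fun v : V => pure_tensor v k) : v w / v + w}.
Proof. by move=> v w; apply/rowP=> i; rewrite !mxE linearD rmorphD mulrDl. Qed.

Lemma pure_tensorDr (V : vectType F) (v : V) :
  {morph pure_tensor v : k l / k + l}.
Proof. by move=> k l; apply/rowP=> i; rewrite !mxE mulrDr. Qed.

Lemma pure_tensorZl (V : vectType F) c (v : V) k :
  pure_tensor (c *: v) k = pure_tensor v (phi c * k).
Proof.
by apply/rowP=> i; rewrite !mxE linearZ rmorphM mulrA [phi c * _]mulrC.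
Qed.

Lemma pure_tensorZr (V : vectType F) (v : V) k l :
  k *: pure_tensor v l = pure_tensor v (k * l).
Proof. by apply/rowP=> i; rewrite !mxE mulrCA. Qed.

Lemma scalext_sum (V : vectType F) (x : scalext phi V) :
  x = \sum_(i < \dim {:V}) pure_tensor (vbasis {:V})`_i (x 0 i).
Proof.
apply/rowP=> j; rewrite summxE (bigD1 j) //= pure_tensorE coord_e eqxx rmorph1.
rewrite mul1r big1 ?addr0 // => i ij.
by rewrite pure_tensorE coord_e eq_sym (negPf ij) rmorph0 mul0r.
Qed.

Lemma scalext_ind (V : vectType F) (P : scalext phi V -> Prop) :
    (forall v k, P (pure_tensor v k)) ->
    (forall x y, P x -> P y -> P (x + y)) ->
  forall x, P x.
Proof.
move=> Ppure PD x; rewrite (scalext_sum x).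
elim/big_ind: _ => [|//|i _]; last exact: Ppure.
have -> : 0 = pure_tensor 0 0 :> scalext phi V.
  by apply/rowP=> i; rewrite !mxE mulr0.
exact: Ppure.
Qed.

Lemma pure_tensor_universal (V : vectType F) (M : zmodType) (b : V -> K -> M) :
    (forall k, {morph b^~ k : v w / v + w}) ->
    (forall v, {morph b v : k l / k + l}) ->
    (forall c v k, b (c *: v) k = b v (phi c * k)) ->
  exists! g : scalext phi V -> M,
    {morph g : x y / x + y} /\ forall v k, g (pure_tensor v k) = b v k.
Proof.
move=> bDl bDr bZ; have b0 k : b 0 k = 0.
  by apply: (addrI (b 0 k)); rewrite -bDl !addr0.
have add0 (g : scalext phi V -> M) : {morph g : x y / x + y} -> g 0 = 0.
  by move=> gD; apply: (addrI (g 0)); rewrite -gD !addr0.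
exists (fun x : scalext phi V =>
          \sum_(i < \dim {:V}) b (vbasis {:V})`_i (x 0 i)); split.
  split=> [x y|v k].
    by rewrite -big_split; apply: eq_bigr => i _; rewrite mxE bDr.
  rewrite [in RHS](coord_vbasis (memvf v)).
  rewrite (big_morph (b^~ k) (bDl k) (b0 k)).
  by apply: eq_bigr => i _; rewrite bZ pure_tensorE.
move=> g [gD gb]; apply: funext => x.
rewrite [in RHS](scalext_sum x) (big_morph g gD (add0 g gD)).
by apply: eq_bigr => i _; rewrite gb.
Qed.

Lemma pure_tensor_suml (V : vectType F) (I : finType) (u : I -> V) k :
  pure_tensor (\sum_i u i) k = \sum_i pure_tensor (u i) k.
Proof.
apply: (big_morph (fun v => pure_tensor v k)) => [v w|].
  exact: pure_tensorDl.
by apply/rowP=> i; rewrite !mxE linear0 rmorph0 mul0r.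
Qed.

Lemma scalext_map_pure (V W : vectType F) (f : {linear V -> W}) v k :
  scalext_map f (pure_tensor v k) = pure_tensor (f v) k.
Proof.
rewrite [in RHS](coord_vbasis (memvf v)) linear_sum /= pure_tensor_suml.
by apply: eq_bigr => i _; rewrite linearZ pure_tensorZl pure_tensorE.
Qed.

Lemma scalext_quad_pure (V : vectType F) (q : V -> F) v k :
  quadratic_form q ->
  scalext_quad q (pure_tensor v k) = k ^+ 2 * phi (q v).
Proof.
move=> qq; rewrite [in RHS](coord_vbasis (memvf v)) (quadratic_form_sum _ qq).
case: qq => qZ bl br.
have blZ w c x : polar_form q w (c *: x) = c * polar_form q w x.
  have b0 : polar_form q w 0 = 0.
    by have := bl w (-1) 0 0; rewrite scaler0 addr0 mulN1r addNr.
  by have := bl w c x 0; rewrite !addr0 b0 addr0.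
have brZ w c x : polar_form q (c *: x) w = c * polar_form q x w.
  have b0 : polar_form q 0 w = 0.
    by have := br w (-1) 0 0; rewrite scaler0 addr0 mulN1r addNr.
  by have := br w c x 0; rewrite !addr0 b0 addr0.
rewrite rmorphD !rmorph_sum mulrDr !mulr_sumr; congr (_ + _).
  apply: eq_bigr => i _.
  by rewrite qZ pure_tensorE rmorphM rmorphXn exprMn mulrA [k ^+ 2 * _]mulrC.
apply: eq_bigr => i _; rewrite rmorph_sum mulr_sumr; apply: eq_bigr => j _.
rewrite blZ brZ !pure_tensorE !rmorphM.
rewrite mulrACA -expr2 [X in X * _ = _]mulrC.
by rewrite [phi _ * phi (coord _ j v)]mulrC -!mulrA.
Qed.

End ScalarExtensionSpace.

Arguments pure_tensor {F K} phi {V} v k.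
Arguments scalext_map {F K} phi {V W} f x.
Arguments scalext_quad {F K} phi {V} q x.

(* The K-algebra structure of A (x) K, given on pure tensors by               *)
(* (a (x) k) (b (x) l) = ab (x) kl; see scalext_mul_pure.                     *)
Section ScalarExtensionAlgebra.
Variables (F K : fieldType) (phi : {rmorphism F -> K}) (A : falgType F).
Local Notation AK := (scalext phi A).
Local Notation pure := (pure_tensor phi).

Definition scalext_mul (x y : AK) : AK :=
  \sum_(i < \dim {:A}) \sum_(j < \dim {:A})
    pure ((vbasis {:A})`_i * (vbasis {:A})`_j) (x 0 i * y 0 j).

Definition scalext_one : AK := pure 1 1.

Lemma scalext_mul_pure a b k l :
  scalext_mul (pure a k) (pure b l) = pure (a * b) (k * l).
Proof.
rewrite [in RHS](coord_vbasis (memvf a)) [in RHS](coord_vbasis (memvf b)).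
rewrite mulr_suml pure_tensor_suml; apply: eq_bigr => i _.
rewrite mulr_sumr pure_tensor_suml; apply: eq_bigr => j _.
rewrite -scalerAl -scalerAr !pure_tensorZl !pure_tensorE mulrACA.
by rewrite [RHS]/= [phi _ * (_ * (_ * _))]mulrA [phi (coord _ j b) * _]mulrC.
Qed.

Fact scalext_mulDl : left_distributive scalext_mul +%R.
Proof.
move=> x y z; rewrite -big_split; apply: eq_bigr => i _ /=.
rewrite -big_split; apply: eq_bigr => j _ /=.
by rewrite mxE mulrDl pure_tensorDr.
Qed.

Fact scalext_mulDr : right_distributive scalext_mul +%R.
Proof.
move=> x y z; rewrite -big_split; apply: eq_bigr => i _ /=.
rewrite -big_split; apply: eq_bigr => j _ /=.
by rewrite mxE mulrDr pure_tensorDr.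
Qed.

Fact scalext_mulA : associative scalext_mul.
Proof.
move=> x y z; elim/(@scalext_ind _ _ phi): x => [a k|x x' IHx IHx'].
  elim/(@scalext_ind _ _ phi): y => [b l|y y' IHy IHy'].
    elim/(@scalext_ind _ _ phi): z => [c m|z z' IHz IHz'].
      by rewrite !scalext_mul_pure !mulrA.
    by rewrite !scalext_mulDr IHz IHz'.
  by rewrite scalext_mulDl !scalext_mulDr scalext_mulDl IHy IHy'.
by rewrite !scalext_mulDl IHx IHx'.
Qed.

Fact scalext_mul1l : left_id scalext_one scalext_mul.
Proof.
elim/(@scalext_ind _ _ phi) => [a k|x x' IHx IHx'].
  by rewrite scalext_mul_pure !mul1r.
by rewrite scalext_mulDr IHx IHx'.
Qed.

Fact scalext_mul1r : right_id scalext_one scalext_mul.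
Proof.
elim/(@scalext_ind _ _ phi) => [a k|x x' IHx IHx'].
  by rewrite scalext_mul_pure !mulr1.
by rewrite scalext_mulDl IHx IHx'.
Qed.

Fact scalext_one_neq0 : scalext_one != 0.
Proof.
apply: contraNneq (oner_neq0 A) => /rowP one0.
rewrite (coord_vbasis (memvf (1 : A))) big1 // => i _.
have := one0 i; rewrite pure_tensorE mulr1 mxE => /eqP.
by rewrite fmorph_eq0 => /eqP->; rewrite scale0r.
Qed.

HB.instance Definition _ := GRing.Zmodule_isNzRing.Build AK
  scalext_mulA scalext_mul1l scalext_mul1r scalext_mulDl scalext_mulDr
  scalext_one_neq0.

Fact scalext_scaleAl (k : K) (x y : AK) : k *: (x * y) = (k *: x) * y.
Proof.
rewrite scaler_sumr; apply: eq_bigr => i _; rewrite scaler_sumr.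
by apply: eq_bigr => j _; rewrite mxE pure_tensorZr mulrA.
Qed.

HB.instance Definition _ :=
  GRing.Lmodule_isLalgebra.Build K AK scalext_scaleAl.

Fact scalext_scaleAr (k : K) (x y : AK) : k *: (x * y) = x * (k *: y).
Proof.
rewrite scaler_sumr; apply: eq_bigr => i _; rewrite scaler_sumr.
by apply: eq_bigr => j _; rewrite mxE pure_tensorZr mulrCA.
Qed.

HB.instance Definition _ :=
  GRing.Lalgebra_isAlgebra.Build K AK scalext_scaleAr.

HB.instance Definition _ := Algebra_isFalgebra.Build K AK.

End ScalarExtensionAlgebra.

Section CentralSimple.
Variables (F : fieldType) (A : falgType F).

Definition two_sided_ideal (I : {vspace A}) : Prop :=
  forall a x, x \in I -> (a * x \in I) /\ (x * a \in I).

Definition central_simple : Prop :=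
  'Z({:A})%VS = 1%VS /\
  forall I : {vspace A}, two_sided_ideal I -> I = 0%VS \/ I = {:A}%VS.

End CentralSimple.

Section Involutions.
Variables (F : fieldType) (A : falgType F).
Implicit Type sigma : A -> A.

Definition involution sigma : Prop :=
  [/\ {morph sigma : x y / x + y},
      forall x y, sigma (x * y) = sigma y * sigma x
    & involutive sigma].

Definition first_kind sigma : Prop := forall c : F, sigma c%:A = c%:A.

(* sigma_L becomes, through psi, the adjoint involution of a nondegenerate    *)
(* alternating bilinear form on L^(n+1).                                      *)
Definition adjoint_to_alternating (L : fieldType) (phi : {rmorphism F -> L})
    (n : nat) (psi : scalext phi A -> 'M[L]_n.+1) sigma : Prop :=
  exists b : {biscalar 'cV[L]_n.+1},
    [/\ forall u, b u u = 0,
        forall u, (forall v, b u v = 0) -> u = 0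
      & forall x u v,
          b (psi x *m u) v = b u (psi (scalext_map phi sigma x) *m v)].

(* A splitting field of A is a field extension L/F with an L-algebra          *)
(* isomorphism psi between A_L and a matrix algebra over L.  The type of      *)
(* sigma does not depend on the choice of L and psi.                          *)
Definition symplectic sigma : Prop :=
  forall (L : fieldType) (phi : {rmorphism F -> L}) (n : nat)
         (psi : {lrmorphism scalext phi A -> 'M[L]_n.+1}),
    bijective psi -> adjoint_to_alternating psi sigma.

Definition orthogonal_involution sigma : Prop :=
  [/\ involution sigma, first_kind sigma & ~ symplectic sigma].

Definition Alt sigma : set A := [set x - sigma x | x in setT].

(* The set S(A, sigma) *)
Definition alternator_set sigma : set A :=
  [set x | exists c : F, exists2 y, Alt sigma y & sigma x * x = c%:A + y].

(* The alternator form; the value is meaningful on S(A, sigma), where the     *)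
(* scalar is unique when sigma is orthogonal.                                 *)
Definition alternator_form sigma (x : A) : F :=
  xget 0 [set c : F | Alt sigma (sigma x * x + c%:A)].

End Involutions.

(* A subset P of V that is a linear subspace, as an element of {vspace V}     *)
(* (see vspace_ofE); the value is 0 when P is not a linear subspace.          *)
Definition vspace_of (F : fieldType) (V : vectType F) (P : set V) :
    {vspace V} := xget 0%VS [set U : {vspace V} | forall x, x \in U <-> P x].

Lemma vspace_ofE (F : fieldType) (V : vectType F) (P : set V) :
    P 0 -> (forall c x y, P x -> P y -> P (c *: x + y)) ->
  forall x, x \in vspace_of P <-> P x.
Proof.
move=> P0 PD.
suff [U PU] : exists U : {vspace V}, forall x, x \in U <-> P x.
  exact: (@xgetPex _ 0%VS [set U : {vspace V} | forall x, x \in U <-> P x]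
                   (ex_intro _ U PU)).
pose d n := `[< exists2 U : {vspace V},
                  (forall x, x \in U -> P x) & \dim U = n >].
have d0 : exists n, d n.
  exists 0%N; apply/asboolP; exists 0%VS; last exact: dimv0.
  by move=> x; rewrite memv0 => /eqP->.
have dm n : d n -> (n <= \dim {:V})%N.
  by move=> /asboolP[U _ <-]; rewrite dimvS ?subvf.
case: (ex_maxnP d0 dm) => n /asboolP[U UP dimU] maxn; exists U => x.
split=> [/UP//|Px].
have /maxn : d (\dim (<[x]> + U)).
  apply/asboolP; exists (<[x]> + U)%VS => //.
  by move=> _ /memv_addP[_ /vlineP[c ->] [u /UP Pu ->]]; apply: PD.
rewrite -dimU => leU.
have /eqP-> : (U == <[x]> + U)%VS by rewrite eqEdim addvSr.
by rewrite (subvP (addvSl _ _)) ?memv_line.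
Qed.

Section AlternatorSpace.
Variables (F : fieldType) (A : falgType F) (sigma : A -> A).

Definition alternator_space : {vspace A} := vspace_of (alternator_set sigma).

Definition alternator_quad (x : subvs_of alternator_space) : F :=
  alternator_form sigma (vsval x).

Lemma alternator_spaceE :
    (2%N \in [pchar F]) -> involution sigma -> first_kind sigma ->
  forall x, x \in alternator_space <-> alternator_set sigma x.
Proof.
move=> charF [sD sM sK] s1.
have sZ c x : sigma (c *: x) = c *: sigma x.
  by rewrite -[c *: x]mulr_algl sM s1 mulr_algr.
have nn (x : A) : - x = x.
  by rewrite oppr_pchar2 // pchar_lalg.
have AltD y z : Alt sigma y -> Alt sigma z -> Alt sigma (y + z).
  move=> [u _ <-] [v _ <-]; exists (u + v) => //.
  by rewrite sD opprD addrACA.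
have AltZ c y : Alt sigma y -> Alt sigma (c *: y).
  by move=> [u _ <-]; exists (c *: u); rewrite ?sZ ?scalerBr.
apply: vspace_ofE => [|c x y [k [a Aa xE]] [l [b Ab yE]]].
  exists 0, 0; last by rewrite mulr0 scale0r addr0.
  by exists 0 => //; rewrite -(scale0r (0 : A)) sZ !scale0r subr0.
exists (c ^+ 2 * k + l).
pose t := c *: (sigma x * y).
exists (c ^+ 2 *: a + b + (t - sigma t)).
  by apply: (AltD); [apply: (AltD); [apply: AltZ | ] | exists t].
rewrite sD !sZ mulrDl !mulrDr -!scalerAl -!scalerAr xE yE sM sK nn.
rewrite scalerA -expr2 scalerDr scalerDl scalerA -/t.
rewrite -!addrA; congr (_ + _); rewrite [RHS]addrCA; congr (_ + _).
by rewrite [LHS]addrA [LHS]addrC -[LHS]addrA.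
Qed.

End AlternatorSpace.

Definition isometric (K : fieldType) (V W : vectType K)
    (q : V -> K) (q' : W -> K) : Prop :=
  exists f : {linear V -> W}, bijective f /\ forall x, q' (f x) = q x.

Section SeparableExtension.
Variables (F K : fieldType) (phi : {rmorphism F -> K}).

Definition minimal_polynomial (x : K) (p : {poly F}) : Prop :=
  [/\ p \is monic, root (map_poly phi p) x
    & forall q, root (map_poly phi q) x -> p %| q].

(* The existence of the minimal polynomial includes that x is algebraic.      *)
Definition separable_extension : Prop :=
  forall x : K, exists2 p, minimal_polynomial x p & separable_poly p.

End SeparableExtension.

(* Main.v *)
(* In characteristic two, x |-> sigma(x) x is additive modulo Alt(A, sigma),  *)
(* so its class modulo W = F + Alt(A, sigma) is a Frobenius-semilinear map    *)
(* with kernel S(A, sigma).  Over K, if x = sum_j v_j (x) b_j with the b_j    *)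
(* linearly independent over F, the class of sigma_K(x) x is that of          *)
(* sum_j sigma(v_j) v_j (x) b_j^2.  When K/F is separable the squares b_j^2   *)
(* can be taken independent as well, so x in S(A_K, sigma_K) forces every v_j *)
(* into S(A, sigma).  The forms agree because the scalar in F is unique when  *)
(* 1 is not alternating, and this holds for a non-symplectic sigma: over a    *)
(* splitting field, 1 = a - sigma(a) would make sigma adjoint to an           *)
(* alternating form.                                                          *)

From HB Require Import structures.
Require Import Defs.
From mathcomp Require Import all_boot all_order all_algebra falgebra.
From mathcomp Require Import separable sesquilinear ring.
From mathcomp Require Import boolp classical_sets.

Set Implicit Arguments.
Unset Strict Implicit.
Unset Printing Implicit Defensive.

Import GRing.Theory.
Local Open Scope ring_scope.
Local Open Scope classical_set_scope.

(** * Anti-automorphisms of matrix algebras *)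

(** Two facts about [altv sigma], the space of elements [a - sigma a], carry the proof. The first is
    [1 \notin altv sigma]: otherwise [alternating_adjoint_form] would make [sigma] symplectic
    ([symplectic_one_altv]). A projection killing [altv sigma] carries this over to [K]
    ([scalext_one_altv]), so the scalars defining both alternator forms are unique. The second is
    [norm_sum_altv]: modulo alternating elements, [sigma x * x] is additive in [x]. It yields at
    once that S(A) (x) K lies in S(A_K) and that the forms agree there ([scalext_alternator_quad]).
    For the converse inclusion, [finite_subalgebra] expands an element of A_K as a sum of tensors of
    [v j] with [b j], where the [b j] form a basis of a finite-dimensional F-subalgebra of [K].
    Separability keeps the squares of the [b j] independent ([ffree_sqr]), so the classes of
    [sigma (v j) * v j] modulo F + Alt vanish one by one ([alternator_set_pure]). *)

Section MatrixForms.
Variables (L : fieldType) (n : nat).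

Definition mx_form (G : 'M[L]_n.+1) (u v : 'cV[L]_n.+1) : L :=
  (u^T *m G *m v) 0 0.

Fact mx_form_linearl (G : 'M[L]_n.+1) v : scalar ((mx_form G)^~ v).
Proof. by move=> c x y; rewrite /mx_form linearP !mulmxDl -!scalemxAl !mxE. Qed.

Fact mx_form_linearr (G : 'M[L]_n.+1) u : scalar (mx_form G u).
Proof. by move=> c x y; rewrite /mx_form mulmxDr -scalemxAr !mxE. Qed.

HB.instance Definition _ (G : 'M[L]_n.+1) :=
  bilinear_isBilinear.Build L 'cV[L]_n.+1 'cV[L]_n.+1 L *%R *%R
    (mx_form G) (mx_form_linearl G, mx_form_linearr G).

(* Skolem-Noether for anti-automorphisms. *)
Lemma matrix_antiautomorphism_form (tau : {linear 'M[L]_n.+1 -> 'M[L]_n.+1}) :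
    (forall X Y, tau (X *m Y) = tau Y *m tau X) -> injective tau ->
  exists2 G : 'M[L]_n.+1, G != 0 & forall X, X^T *m G = G *m tau X.
Proof.
move=> tauM tau_inj; pose E (i : 'I_n.+1) : 'M[L]_n.+1 := delta_mx i 0.
have [k [l tkl]] : exists k l, tau (E 0) k l != 0.
  apply: contrapT => tau0; have : tau (E 0) = tau 0.
    apply/matrixP => k l; rewrite linear0 mxE; apply/eqP.
    by apply: contrapT => /negP tkl; apply: tau0; exists k, l.
  by move/tau_inj/matrixP/(_ 0 0)/eqP; rewrite !mxE !eqxx /= oner_eq0.
(* With this [C], row [i] of the sum [G] of the [E i *m C *m tau (E i)] is row [k] of [tau (E i)],
   so [G] has a nonzero entry in row 0. Left multiplication by [X] permutes the [E i] linearly by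
   [XE], which is what makes [G] intertwine [X^T] with [tau X]. *)
pose C : 'M[L]_n.+1 := delta_mx 0 k.
have XE (X : 'M[L]_n.+1) i : X *m E i = \sum_j X j i *: E j.
  apply/matrixP => a b; rewrite !mxE summxE (bigD1 i) //= [in RHS](bigD1 a) //=.
  rewrite !mxE !eqxx !big1 ?addr0 // => j ji.
    by rewrite !mxE eq_sym (negPf ji) mulr0.
  by rewrite !mxE (negPf ji) mulr0.
exists (\sum_i E i *m C *m tau (E i)).
  apply: contraNneq tkl => G0.
  have : delta_mx 0 0 *m (\sum_i E i *m C *m tau (E i)) = 0 :> 'M_n.+1.
    by rewrite G0 mulmx0.
  rewrite mulmx_sumr (bigD1 0) //= big1 ?addr0 => [|i i0].
    move/matrixP/(_ 0 l); rewrite !mulmxA !mul_delta_mx !mxE (bigD1 k) //=.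
    rewrite big1 => [|j jk].
      by rewrite !mxE !eqxx mul1r addr0 => ->.
    by rewrite !mxE (negPf jk) andbF mul0r.
  by rewrite !mulmxA mul_delta_mx_0 ?mul0mx // eq_sym.
move=> X; rewrite mulmx_sumr mulmx_suml.
under eq_bigr => i _ do rewrite !mulmxA XE !mulmx_suml.
under [RHS]eq_bigr => i _ do rewrite -mulmxA -tauM XE linear_sum mulmx_sumr.
rewrite exchange_big /=; apply: eq_bigr => i _; apply: eq_bigr => j _.
by rewrite linearZ -!scalemxAl -scalemxAr mxE.
Qed.

(** The adjunction makes the left radical stable under every matrix. A nonzero [u] in it can be
    moved to a multiple of each basis vector, and then every row of [G] vanishes. *)
Lemma mx_form_nondegenerate (G : 'M[L]_n.+1)
    (tau : 'M[L]_n.+1 -> 'M[L]_n.+1) u :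
    G != 0 -> (forall X, X^T *m G = G *m tau X) ->
  (forall v, mx_form G u v = 0) -> u = 0.
Proof.
move=> G0 adj uG; have {}uG : u^T *m G = 0.
  by apply/rowP => j; have := uG (delta_mx j 0); rewrite /mx_form -colE !mxE.
apply: contraNeq G0 => /cV0Pn[i ui0]; apply/eqP/row_matrixP => j; rewrite row0.
have : (delta_mx j i *m u)^T *m G = 0.
  by rewrite trmx_mul -mulmxA adj mulmxA uG mul0mx.
have -> : delta_mx j i *m u = u i 0 *: delta_mx j 0.
  apply/colP => a; rewrite !mxE (bigD1 i) //= big1 ?addr0 => [|b bi].
    by rewrite !mxE !eqxx !andbT mulrC.
  by rewrite mxE (negPf bi) andbF mul0r.
rewrite linearZ /= -scalemxAl trmx_delta -rowE => /eqP.
by rewrite scaler_eq0 (negPf ui0) => /eqP.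
Qed.

(* If the form given by Skolem-Noether is not symmetric, then its             *)
(* antisymmetrization is adjoint to tau as well; if it is, then               *)
(* [1 = a - tau a] makes it alternating.                                      *)
Lemma alternating_adjoint_form (tau : {linear 'M[L]_n.+1 -> 'M[L]_n.+1}) a :
    (forall X Y, tau (X *m Y) = tau Y *m tau X) -> involutive tau ->
    1%:M = a - tau a ->
  exists b : {biscalar 'cV[L]_n.+1},
    [/\ forall u, b u u = 0,
        forall u, (forall v, b u v = 0) -> u = 0
      & forall X u v, b (X *m u) v = b u (tau X *m v)].
Proof.
move=> tauM tauK one_alt.
suff [G [G0 adj alt]] : exists G : 'M[L]_n.+1,
    [/\ G != 0, forall X, X^T *m G = G *m tau X & forall u, mx_form G u u = 0].
  exists (mx_form G); split=> // [u|X u v].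
    exact: mx_form_nondegenerate adj.
  by rewrite /= /mx_form trmx_mul -!mulmxA [X^T *m _]mulmxA adj !mulmxA.
have tr00 (x : 'M[L]_1) : x 0 0 = x^T 0 0 by rewrite mxE.
have mxB (x y : 'M[L]_1) : (x - y) 0 0 = x 0 0 - y 0 0 by rewrite !mxE.
have [G G0 adj] := matrix_antiautomorphism_form tauM (inv_inj tauK).
have [Gsym|/eqP Gnsym] := pselect (G^T = G).
  exists G; split=> // u; rewrite /mx_form.
  (* Inserting [1 = a - tau a] after [G] turns the value into [u^T *m G *m a *m u] minus its own
     transpose, a scalar. *)
  rewrite -[G in u^T *m G]mulmx1 one_alt mulmxBr -adj mulmxBr mulmxBl.
  rewrite mxB [X in X - _]tr00 !trmx_mul trmxK Gsym !mulmxA.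
  exact: subrr.
exists (G - G^T); split=> [|X|u]; first by rewrite subr_eq0 eq_sym.
  rewrite mulmxBr mulmxBl adj; congr (_ - _).
  (* Transposing the adjunction for [tau X] gives the one for [X] with [G^T] in place of [G]. *)
  by rewrite -trmx_mul -{1}[X]tauK -adj trmx_mul trmxK.
rewrite /mx_form mulmxBr mulmxBl mxB [X in X - _]tr00 !trmx_mul trmxK mulmxA.
exact: subrr.
Qed.

End MatrixForms.

(** * Squares in separable extensions *)

Section FiniteSubalgebras.
Variables (F K : fieldType) (phi : {rmorphism F -> K}).

(** Since [K] may have infinite degree over [F], its finite-dimensional F-subspaces are given by
    finite generating families. *)
Definition fspan (I : finType) (b : I -> K) (x : K) : Prop :=
  exists c : I -> F, x = \sum_i phi (c i) * b i.

Definition ffree (I : finType) (b : I -> K) : Prop :=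
  forall c : I -> F, \sum_i phi (c i) * b i = 0 -> forall i, c i = 0.

Lemma fspan_sum (I J : finType) (b : I -> K) (c : J -> F) (y : J -> K) :
  (forall j, fspan b (y j)) -> fspan b (\sum_j phi (c j) * y j).
Proof.
move=> /fin_all_exists[d yE]; exists (fun i => \sum_j c j * d j i).
under eq_bigr => j _ do rewrite yE mulr_sumr.
rewrite exchange_big; apply: eq_bigr => i _.
by rewrite rmorph_sum mulr_suml; apply: eq_bigr => j _; rewrite rmorphM mulrA.
Qed.

Lemma fspan_trans (I J : finType) (b : I -> K) (b' : J -> K) x :
  (forall i, fspan b' (b i)) -> fspan b x -> fspan b' x.
Proof. by move=> bb' [c ->]; apply: fspan_sum. Qed.

Lemma fspan_mem (I : finType) (b : I -> K) i : fspan b (b i).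
Proof.
exists (fun j => (j == i)%:R); rewrite (bigD1 i) //= eqxx rmorph1 mul1r.
rewrite big1 ?addr0 //.
by move=> j /negPf->; rewrite rmorph0 mul0r.
Qed.

Lemma fspan_mul (I J : finType) (b : I -> K) (b' : J -> K) x y :
  fspan b x -> fspan b' y -> fspan (fun ij : I * J => b ij.1 * b' ij.2) (x * y).
Proof.
move=> [c ->] [d ->]; exists (fun ij => c ij.1 * d ij.2).
rewrite big_distrlr pair_big; apply: eq_bigr => -[i j] _ /=.
by rewrite rmorphM mulrACA.
Qed.

(** A nontrivial relation expresses one generator through the others, and that generator is
    dropped. *)
Lemma fspan_basis (I : finType) (b : I -> K) :
  exists n (b' : 'I_n -> K), ffree b' /\ forall x, fspan b' x <-> fspan b x.
Proof.
suff main n (d : 'I_n -> K) : exists m (b' : 'I_m -> K),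
    ffree b' /\ forall x, fspan b' x <-> fspan d x.
  have [m [b' [b'_free b'E]]] := main _ (b \o @enum_val I xpredT).
  exists m, b'; split=> // x; rewrite b'E; split; apply: fspan_trans => i.
    exact: fspan_mem.
  have := fspan_mem (b \o @enum_val I xpredT) (enum_rank i).
  by rewrite /= enum_rankK.
elim: n d => [|n IHn] d; first by exists 0, d; split=> // c _ [].
have [d_free|/existsNP[c /not_implyP[cd0 /existsNP[i /eqP ci0]]]] :=
  pselect (ffree d).
  by exists n.+1, d.
have [m [b' [b'_free b'E]]] := IHn (d \o lift i).
exists m, b'; split=> // x; rewrite b'E; split; apply: fspan_trans => j /=.
  exact: fspan_mem.
have [k ->|->] := unliftP i j; first exact: (fspan_mem (d \o lift i)).
exists (fun k => - (c i)^-1 * c (lift i k)).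
move: cd0; rewrite (bigD1_ord i) //= => /(canRL (addrK _)); rewrite sub0r => dE.
have /mulfI : phi (c i) != 0 by rewrite fmorph_eq0.
apply; rewrite dE mulr_sumr -sumrN; apply: eq_bigr => k _ /=.
by rewrite mulNr rmorphN mulNr mulrN rmorphM fmorphV -mulrA mulVKf ?fmorph_eq0.
Qed.

Definition fsubalgebra (I : finType) (b : I -> K) : Prop :=
  fspan b 1 /\ forall i j, fspan b (b i * b j).

Lemma fsubalgebraM (I : finType) (b : I -> K) x y :
  fsubalgebra b -> fspan b x -> fspan b y -> fspan b (x * y).
Proof.
move=> [_ bM] bx b_y; have := fspan_mul bx b_y; apply: fspan_trans => -[i j].
exact: bM.
Qed.

Lemma fsubalgebraX (I : finType) (b : I -> K) x n :
  fsubalgebra b -> fspan b x -> fspan b (x ^+ n).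
Proof.
move=> balg bx; elim: n => [|n IHn]; first by case: balg.
by rewrite exprS; apply: fsubalgebraM.
Qed.

Lemma fspan_powers (p q : {poly F}) (x : K) :
    p != 0 -> root (map_poly phi p) x ->
  fspan (fun j : 'I_(size p).-1 => x ^+ j) (map_poly phi q).[x].
Proof.
move=> p0 /rootP px0; exists (fun j : 'I_(size p).-1 => (q %% p)`_j).
rewrite [q in LHS](divp_eq q p) rmorphD rmorphM hornerD hornerM px0 mulr0 add0r.
rewrite (horner_coef_wide (n := (size p).-1)) ?size_map_poly.
  by apply: eq_bigr => j _; rewrite coef_map.
by rewrite -ltnS prednK ?size_poly_gt0 // ltn_modp.
Qed.

(** The products of the [b i] with the powers of [x] below the degree of [p] suffice, higher powers
    being reduced modulo [p]. *)
Lemma fsubalgebra_adjoin (I : finType) (b : I -> K) (p : {poly F}) x :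
    fsubalgebra b -> p != 0 -> root (map_poly phi p) x ->
  exists (J : finType) (b' : J -> K),
    [/\ fsubalgebra b', fspan b' x & forall y, fspan b y -> fspan b' y].
Proof.
move=> [b1 bM] p0 px0; pose pw := fun j : 'I_(size p).-1 => x ^+ j.
have pwX m : fspan pw (x ^+ m).
  by have := fspan_powers 'X^m p0 px0; rewrite map_polyXn hornerXn.
exists (I * 'I_(size p).-1)%type, (fun ij => b ij.1 * pw ij.2).
split=> [||y b_y].
- split=> [|[i j] [k l]].
    by rewrite -[1]mulr1; exact: (fspan_mul b1 (pwX 0)).
  by rewrite mulrACA /pw -exprD; exact: (fspan_mul (bM i k) (pwX _)).
- by rewrite -[x]mul1r; exact: (fspan_mul b1 (pwX 1)).
- by rewrite -[y]mulr1; exact: (fspan_mul b_y (pwX 0)).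
Qed.

Definition falgebraic : Prop :=
  forall x : K, exists2 p : {poly F}, p != 0 & root (map_poly phi p) x.

Lemma finite_subalgebra (s : seq K) : falgebraic ->
  exists n (b : 'I_n -> K),
    [/\ ffree b, fsubalgebra b & forall x, x \in s -> fspan b x].
Proof.
move=> alg; suff [I [b [[b1 bM] bs]]] : exists (I : finType) (b : I -> K),
    fsubalgebra b /\ forall x, x \in s -> fspan b x.
  have [n [b' [b'_free b'E]]] := fspan_basis b; exists n, b'; split=> //.
    split=> [|i j]; rewrite b'E //; apply: fsubalgebraM => //; rewrite -b'E;
    exact: fspan_mem.
  by move=> x /bs; rewrite b'E.
elim: s => [|x s [I [b [balg bs]]]].
  exists unit, (fun=> 1); split=> //; have b1 := fspan_mem (fun=> 1 : K) tt.
  by split=> // i j; rewrite mulr1.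
have [p p0 px0] := alg x.
have [J [b' [b'alg b'x bb']]] := fsubalgebra_adjoin balg p0 px0.
by exists J, b'; split=> // y; rewrite inE => /predU1P[->|/bs/bb'].
Qed.

End FiniteSubalgebras.

Section SeparableSquares.
Variables (F K : fieldType) (phi : {rmorphism F -> K}).
Hypothesis charF : 2%N \in [pchar F].

(* Writing p = e(X^2) + X o(X^2), characteristic two gives p' = o(X^2), and a *)
(* Bezout relation [u p + v p' = 1] evaluated at x inverts o(x^2) in F[x^2],  *)
(* while p(x) = 0 reads [x o(x^2) = e(x^2)].                                  *)
Lemma separable_root_sqr (p : {poly F}) x :
    separable_poly p -> root (map_poly phi p) x ->
  exists q : {poly F}, x = (map_poly phi q).[x ^+ 2].
Proof.
rewrite unlock => /Bezout_eq1_coprimepP[[u v] /= uv1] /rootP px0.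
pose S (q : {poly F}) := (map_poly phi q).[x ^+ 2].
have SX2 q : (map_poly phi (q \Po 'X^2)).[x] = S q.
  by rewrite map_comp_poly map_polyXn horner_comp hornerXn.
have mX : (map_poly phi ('X : {poly F})).[x] = x by rewrite map_polyX hornerX.
have splitS q : (map_poly phi q).[x] = S (even_poly q) + S (odd_poly q) * x.
  by rewrite -{1}(poly_even_odd q) rmorphD rmorphM hornerD hornerM !SX2 mX.
have charK : 2%N \in [pchar K] by rewrite (fmorph_pchar phi).
have dp : p^`() = odd_poly p \Po 'X^2.
  have dX2 : ('X^2 : {poly F})^`() = 0.
    by rewrite derivXn mulr2n addrr_pchar2 ?pchar_lalg.
  rewrite -{1}(poly_even_odd p) derivD derivM !deriv_comp dX2 !mulr0.
  by rewrite mul0r !add0r derivX mulr1.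
move: px0; rewrite splitS => /eqP; rewrite addrC addr_eq0 oppr_pchar2 //.
move=> /eqP oE.
have := congr1 (fun q => (map_poly phi q).[x]) uv1.
rewrite rmorphD !rmorphM !hornerD !hornerM rmorph1 hornerC.
rewrite [(map_poly phi p).[x]]splitS oE addrr_pchar2 // mulr0 add0r.
rewrite dp SX2 splitS => one.
(* This is [one] multiplied by [x]: in the even part of [v], [oE] replaces [x] times the odd part of
   [p] by the even part; in the odd part of [v], the two factors [x] give [x ^+ 2]. *)
exists (even_poly v * even_poly p + odd_poly v * 'X * odd_poly p).
have SD a c : S (a + c) = S a + S c by rewrite /S rmorphD hornerD.
have SM a c : S (a * c) = S a * S c by rewrite /S rmorphM hornerM.
have SX : S 'X = x ^+ 2 by rewrite /S map_polyX hornerX.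
by rewrite -/(S _) SD !SM SX -[LHS]mul1r -one -oE; ring.
Qed.

Lemma fspan_sqr (I : finType) (b : I -> K) x :
  fspan phi b x -> fspan phi (fun i => b i ^+ 2) (x ^+ 2).
Proof.
have charK : 2%N \in [pchar K] by rewrite (fmorph_pchar phi).
move=> [c ->]; exists (fun i => c i ^+ 2).
rewrite -(pFrobenius_autE charK) rmorph_sum; apply: eq_bigr => i _.
by rewrite -[LHS]/((_ * _) ^+ 2) exprMn rmorphXn.
Qed.

(* Each b i lies in F[b i ^ 2], so the squares span the same                  *)
(* finite-dimensional algebra as the basis b.                                 *)
Lemma ffree_sqr n (b : 'I_n -> K) :
    (forall x : K, exists2 p : {poly F},
       separable_poly p & root (map_poly phi p) x) ->
    ffree phi b -> fsubalgebra phi b -> ffree phi (fun i => b i ^+ 2).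
Proof.
move=> sep b_free balg.
have /fin_all_exists[C CE] i : fspan phi (fun j => b j ^+ 2) (b i).
  have [p psep pbi] := sep (b i); have [q qE] := separable_root_sqr psep pbi.
  rewrite qE horner_coef size_map_poly.
  (* A power of [b i ^+ 2] is the square of a power of [b i], which lies in the span of [b]. *)
  under eq_bigr => k _ do rewrite coef_map exprAC.
  apply: fspan_sum => k; apply: fspan_sqr; apply: fsubalgebraX => //.
  exact: fspan_mem.
have /fin_all_exists[D DE] i : fspan phi b (b i ^+ 2).
  by apply: fsubalgebraX => //; apply: fspan_mem.
(* [MC] writes the [b i] in terms of their squares and [MD] the squares in terms of [b]. Freeness of
   [b] gives [MC *m MD = 1]; the matrices being square, [MD] is invertible, and a relation [U] among
   the squares satisfies [U *m MD = 0]. *)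
pose MC := \matrix_(i, j) C i j; pose MD := \matrix_(i, j) D i j.
have CD1 : MC *m MD = 1%:M.
  apply/matrixP => i k; rewrite [RHS]mxE.
  suff /(b_free _)/(_ k)/eqP :
      \sum_k phi ((MC *m MD) i k - (i == k)%:R) * b k = 0.
    by rewrite subr_eq0 => /eqP.
  under eq_bigr => l _ do rewrite rmorphB mulrBl.
  rewrite sumrB; apply/eqP; rewrite subr_eq0; apply/eqP.
  rewrite [RHS](bigD1 i) //= eqxx rmorph1 mul1r [X in _ = _ + X]big1 ?addr0.
    rewrite [RHS]CE; under [RHS]eq_bigr => j _ do rewrite DE mulr_sumr.
    rewrite exchange_big; apply: eq_bigr => l _ /=.
    rewrite mxE rmorph_sum mulr_suml; apply: eq_bigr => j _.
    by rewrite !mxE rmorphM mulrA.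
  by move=> j /negPf; rewrite eq_sym => ->; rewrite rmorph0 mul0r.
move=> u u0; pose U := \row_i u i.
suff /rowP U0 : U = 0 by move=> i; have := U0 i; rewrite !mxE.
suff UD0 : U *m MD = 0 by rewrite -[U]mulmx1 -(mulmx1C CD1) mulmxA UD0 mul0mx.
apply/rowP => k; rewrite [RHS]mxE.
apply: (b_free (fun k => (U *m MD) 0 k)); rewrite -[RHS]u0.
under [RHS]eq_bigr => j _ do rewrite DE mulr_sumr.
rewrite exchange_big; apply: eq_bigr => l _ /=.
rewrite mxE rmorph_sum mulr_suml; apply: eq_bigr => j _.
by rewrite !mxE rmorphM mulrA.
Qed.

End SeparableSquares.

(** * Scalar extension and alternating elements *)

Lemma linear_funP (R : pzRingType) (U V : lmodType R) (f : U -> V) :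
  linear f -> exists g : {linear U -> V}, f = g.
Proof.
move=> flin; pose fL := GRing.isLinear.Build R U V *:%R f flin.
by exists (HB.pack_for {linear U -> V} f fL).
Qed.

Section ScalarExtensionMaps.
Variables (F K : fieldType) (phi : {rmorphism F -> K}).
Local Notation pure := (pure_tensor phi).

Fact scalext_map_is_linear (V W : vectType F) (f : V -> W) :
  linear (scalext_map phi f).
Proof.
move=> k x y; rewrite /scalext_map scaler_sumr -big_split.
by apply: eq_bigr => i _ /=; rewrite pure_tensorZr !mxE pure_tensorDr.
Qed.

HB.instance Definition _ (V W : vectType F) (f : V -> W) :=
  GRing.isLinear.Build K (scalext phi V) (scalext phi W) *:%R
    (scalext_map phi f) (scalext_map_is_linear f).

Lemma scalext_map_comp (U V W : vectType F) (f : {linear U -> V})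
    (g : {linear V -> W}) x :
  scalext_map phi g (scalext_map phi f x) = scalext_map phi (g \o f) x.
Proof.
elim/(@scalext_ind _ _ phi): x => [v k|x y IHx IHy].
  by rewrite !scalext_map_pure.
by rewrite !linearD /= IHx IHy.
Qed.

Lemma scalext_mapK (V W : vectType F) (f : {linear V -> W})
    (g : {linear W -> V}) :
  cancel f g -> cancel (scalext_map phi f) (scalext_map phi g).
Proof.
move=> fK; elim/(@scalext_ind _ _ phi) => [v k|x y IHx IHy].
  by rewrite !scalext_map_pure fK.
by rewrite !linearD /= IHx IHy.
Qed.

(** Each coordinate of the sum is an F-linear relation among the [b i]. *)
Lemma sum_pure_tensor_eq0 (V : vectType F) (I : finType) (v : I -> V)
    (b : I -> K) :
  ffree phi b -> \sum_i pure (v i) (b i) = 0 -> forall i, v i = 0.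
Proof.
move=> b_free s0 i; rewrite (coord_vbasis (memvf (v i))) big1 // => j _.
have /b_free/(_ i)-> : \sum_i phi (coord (vbasis {:V}) j (v i)) * b i = 0.
  have /rowP/(_ j) := s0; rewrite summxE [RHS]mxE => s0j; rewrite -[RHS]s0j.
  by apply: eq_bigr => l _; rewrite pure_tensorE.
by rewrite scale0r.
Qed.

Lemma ffree1 : ffree phi (fun _ : 'I_1 => 1).
Proof.
move=> c; rewrite big_ord1 mulr1 => /eqP; rewrite fmorph_eq0 => /eqP c0 i.
by rewrite ord1.
Qed.

Lemma pure_tensor1_eq0 (V : vectType F) (v : V) : pure v 1 = 0 -> v = 0.
Proof.
move=> v0; apply: (sum_pure_tensor_eq0 (v := fun=> v) ffree1 _ ord0).
by rewrite big_ord1.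
Qed.

Lemma fspan_pure_tensor (V : vectType F) (x : scalext phi V) (I : finType)
    (b : I -> K) : (forall i, fspan phi b (x 0 i)) ->
  exists v : I -> V, x = \sum_j pure (v j) (b j).
Proof.
move=> /fin_all_exists[c xE].
exists (fun j => \sum_i c i j *: (vbasis {:V})`_i).
under eq_bigr => j _ do rewrite pure_tensor_suml.
rewrite exchange_big [LHS]scalext_sum; apply: eq_bigr => i _ /=.
have s0 : pure (vbasis {:V})`_i 0 = 0 by apply/rowP => j; rewrite !mxE mulr0.
rewrite xE (big_morph _ (pure_tensorDr phi (vbasis {:V})`_i) s0).
by apply: eq_bigr => j _; rewrite pure_tensorZl.
Qed.

End ScalarExtensionMaps.

Section AlternatingElements.
Variables (F : fieldType) (A : falgType F) (sigma : {linear A -> A}).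

(** [Alt] as the image of a linear map, so that sums with F and projections are available. *)
Definition altv : {vspace A} := limg (\1 - linfun sigma)%VF.

Lemma AltP y : Alt sigma y <-> y \in altv.
Proof.
have altE t : (\1 - linfun sigma)%VF t = t - sigma t.
  by rewrite add_lfunE opp_lfunE id_lfunE lfunE.
split=> [[t _ <-]|/memv_imgP[t _ ->]]; last by exists t.
by rewrite -altE memv_img ?memvf.
Qed.

Lemma mem_altv t : t - sigma t \in altv.
Proof. by apply/AltP; exists t. Qed.

Hypothesis charF : 2%N \in [pchar F].
Hypothesis sigmaM : forall x y, sigma (x * y) = sigma y * sigma x.
Hypothesis sigmaK : involutive sigma.

(** In characteristic two the cross terms [sigma y * z + sigma z * y] equal [t - sigma t] for
    [t = sigma y * z]. *)
Lemma norm_sum_altv (I : finType) (x : I -> A) :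
  sigma (\sum_i x i) * (\sum_i x i) - \sum_i sigma (x i) * x i \in altv.
Proof.
have nn (a : A) : - a = a by rewrite oppr_pchar2 // pchar_lalg.
elim/big_ind2: _ => [|y' y z' z Hy Hz|i _]; last by rewrite subrr mem0v.
  by rewrite mulr0 subrr mem0v.
have -> : sigma (y + z) * (y + z) - (y' + z') =
    (sigma y * y - y') + (sigma z * z - z') +
    (sigma y * z - sigma (sigma y * z)).
  rewrite sigmaM sigmaK !nn linearD mulrDl !mulrDr.
  by rewrite (AC (2*2*2) ((1*5)*(4*6)*(2*3))).
by apply: rpredD; [apply: rpredD|apply: mem_altv].
Qed.

Hypothesis one_altv : 1 \notin altv.

Lemma alternator_formE x c :
  sigma x * x + c%:A \in altv -> alternator_form sigma x = c.
Proof.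
move=> xc; apply: xget_unique => [|d /AltP xd]; first exact/AltP.
apply/eqP; rewrite -subr_eq0; apply: contraNT one_altv => dc.
have : (d - c)%:A \in altv.
  by have := rpredB xd xc; rewrite opprD addrACA subrr add0r -scalerBl.
by rewrite rpredZeq (negPf dc).
Qed.

Lemma alternator_formP x : alternator_set sigma x ->
  sigma x * x + (alternator_form sigma x)%:A \in altv.
Proof.
move=> [c [y /AltP y_alt xE]].
suff xc : sigma x * x + c%:A \in altv by rewrite (alternator_formE xc).
by rewrite xE addrAC addrr_pchar2 ?pchar_lalg // add0r.
Qed.

Lemma alternator_setP x :
  alternator_set sigma x <-> sigma x * x \in (1 + altv)%VS.
Proof.
split=> [[c [y /AltP y_alt xE]]|/memv_addP[_ /vlineP[c ->] [y /AltP y_alt xE]]].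
  by rewrite xE memv_add // rpredZ // memv_line.
by exists c, y.
Qed.

End AlternatingElements.

(** * The alternator form under scalar extension *)

Section ScalarExtensionInvolution.
Variables (F K : fieldType) (phi : {rmorphism F -> K}).
Variables (A : falgType F) (sigma : {linear A -> A}).
Hypothesis sigmaM : forall x y, sigma (x * y) = sigma y * sigma x.
Hypothesis sigmaK : involutive sigma.
Hypothesis sigma1 : first_kind sigma.
Local Notation pure := (pure_tensor phi).
Local Notation sK := (scalext_map phi sigma).

Lemma scalext_involutionM (x y : scalext phi A) : sK (x * y) = sK y * sK x.
Proof.
elim/(@scalext_ind _ _ phi): x => [a k|x x' IHx IHx'].
  elim/(@scalext_ind _ _ phi): y => [b l|y y' IHy IHy'].
    rewrite [_ * _]scalext_mul_pure !scalext_map_pure sigmaM mulrC.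
    by rewrite -scalext_mul_pure.
  by rewrite mulrDr !linearD /= IHy IHy' mulrDl.
by rewrite mulrDl !linearD /= IHx IHx' mulrDr.
Qed.

Lemma scalext_involutionK : involutive sK.
Proof. exact: scalext_mapK. Qed.

Lemma scalext_involution_first_kind : first_kind sK.
Proof.
move=> c; rewrite linearZ /= [1]/(pure 1 1) scalext_map_pure.
by have := sigma1 1; rewrite scale1r => ->.
Qed.

Lemma pure_altv a k : a \in altv sigma -> pure a k \in altv sK.
Proof.
move=> /AltP[t _ <-]; apply/AltP; exists (pure t k) => //.
rewrite /= scalext_map_pure; apply/rowP => i.
by rewrite !mxE linearB rmorphB mulrBl.
Qed.

(** Killing [altv sigma] means [g \o sigma = g], an identity that survives scalar extension.
    Alternating elements over [K] are thus tested by maps defined over [F]. *)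
Lemma scalext_map_alt_eq0 (V : vectType F) (g : {linear A -> V}) y :
    (forall a, a \in altv sigma -> g a = 0) -> y \in altv sK ->
  scalext_map phi g y = 0.
Proof.
move=> g0 /AltP[t _ <-]; rewrite linearB /= scalext_map_comp.
suff -> : g \o sigma = g by rewrite subrr.
apply/funext => a /=; apply/eqP; rewrite eq_sym -subr_eq0 -linearB.
by rewrite g0 // mem_altv.
Qed.

Lemma scalext_one_altv : 1 \notin altv sigma -> 1 \notin altv sK.
Proof.
apply: contraNN => one_alt; pose h := (\1 - projv (altv sigma))%VF.
have hE a : h a = a - projv (altv sigma) a.
  by rewrite add_lfunE opp_lfunE id_lfunE.
have h0 a : a \in altv sigma -> h a = 0 by move=> ?; rewrite hE projv_id ?subrr.
have := scalext_map_alt_eq0 h0 one_alt; rewrite [1]/(pure 1 1) scalext_map_pure.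
move/pure_tensor1_eq0/eqP; rewrite /= hE subr_eq0 => /eqP->.
exact: memv_proj.
Qed.

Hypothesis charF : 2%N \in [pchar F].

Lemma scalext_norm_altv (I : finType) (v : I -> A) (b : I -> K) :
  sK (\sum_i pure (v i) (b i)) * (\sum_i pure (v i) (b i)) -
    \sum_i pure (sigma (v i) * v i) (b i ^+ 2) \in altv sK.
Proof.
have charK : 2%N \in [pchar K] by rewrite (fmorph_pchar phi).
have <- : \sum_i sK (pure (v i) (b i)) * pure (v i) (b i) =
    \sum_i pure (sigma (v i) * v i) (b i ^+ 2).
  apply: eq_bigr => i _.
  by rewrite scalext_map_pure [_ * _]scalext_mul_pure -expr2.
exact: (@norm_sum_altv K (scalext phi A) sK charK
          scalext_involutionM scalext_involutionK).
Qed.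

(** The map [g] has kernel [W], that is F + Alt, and its extension kills the scalars and the
    alternating elements over [K]. Applied to the norm of the sum, it leaves a vanishing sum of the
    [g (sigma (v i) * v i)] tensored with the independent [b i ^+ 2]. *)
Lemma alternator_set_pure (I : finType) (v : I -> A) (b : I -> K) :
    ffree phi (fun i => b i ^+ 2) ->
    alternator_set sK (\sum_i pure (v i) (b i)) ->
  forall i, alternator_set sigma (v i).
Proof.
move=> b_free /alternator_setP x_alt i; apply/alternator_setP.
pose W := (1 + altv sigma)%VS; pose g := (\1 - projv W)%VF.
have gE a : g a = a - projv W a by rewrite add_lfunE opp_lfunE id_lfunE.
have g0 a : a \in W -> g a = 0 by move=> aW; rewrite gE projv_id ?subrr.
have gK_alt y : y \in altv sK -> scalext_map phi g y = 0.
  by apply: scalext_map_alt_eq0 => a a_alt; apply/g0/(subvP (addvSr _ _)).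
have gK1 : scalext_map phi g 1 = 0.
  have g1 : g 1 = 0 by apply/g0/(subvP (addvSl _ _))/memv_line.
  rewrite [1]/(pure 1 1) scalext_map_pure /= g1.
  by apply/rowP => j; rewrite !mxE linear0 rmorph0 mul0r.
have gx0 : scalext_map phi g (\sum_i pure (sigma (v i) * v i) (b i ^+ 2)) = 0.
  have := gK_alt _ (scalext_norm_altv v b); rewrite linearB => /eqP.
  rewrite subr_eq0 => /eqP <-.
  have [_ /vlineP[c ->] [y y_alt ->]] := memv_addP x_alt.
  by rewrite linearD linearZ /= gK1 gK_alt // scaler0 addr0.
move: gx0; rewrite linear_sum /=.
under eq_bigr => j _ do rewrite scalext_map_pure.
move=> /(sum_pure_tensor_eq0 b_free)/(_ i)/eqP.
by rewrite /= gE subr_eq0 => /eqP->; apply: memv_proj.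
Qed.

Hypothesis one_altv : 1 \notin altv sigma.

Local Notation S := (alternator_space sigma).
Local Notation q := (@alternator_quad F A sigma).
Local Notation incl := (vsval : subvs_of S -> A).

Lemma linear_involution : involution sigma.
Proof. by split=> //; apply: linearD. Qed.

Lemma mem_alternator_space x : x \in S <-> alternator_set sigma x.
Proof. exact: alternator_spaceE linear_involution sigma1 x. Qed.

Lemma alternator_quadP (u : subvs_of S) :
  sigma (vsval u) * vsval u + (q u)%:A \in altv sigma.
Proof.
by apply: alternator_formP => //; apply/mem_alternator_space/subvsP.
Qed.

Lemma alternator_quadD (u v : subvs_of S) : q (u + v) = q u + q v.
Proof.
(* By uniqueness of the scalar, it suffices that [q u + q v] corrects the norm of the sum to an
   alternating element. *)
apply: alternator_formE => //; rewrite [vsval (u + v)]linearD /=.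
pose w (i : bool) := if i then vsval u else vsval v.
have := norm_sum_altv charF sigmaM sigmaK w; rewrite !big_bool /= => uv.
have := rpredD uv (rpredD (alternator_quadP u) (alternator_quadP v)).
by rewrite [X in _ + X]addrACA (addrA (_ - _)) subrK -scalerDl.
Qed.

(* Additivity of q makes its polar form vanish, so that only the diagonal     *)
(* terms of its scalar extension remain.                                      *)
Lemma scalext_alternator_quad (z : scalext phi (subvs_of S)) :
  sK (scalext_map phi incl z) * scalext_map phi incl z +
    (scalext_quad phi q z)%:A \in altv sK.
Proof.
pose e (i : 'I_(\dim {:subvs_of S})) := (vbasis {:subvs_of S})`_i.
have -> : scalext_quad phi q z = \sum_i z 0 i ^+ 2 * phi (q (e i)).
  rewrite /scalext_quad [X in _ + X]big1 ?addr0 // => i _; apply: big1 => j _.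
  by rewrite /polar_form alternator_quadD addrAC addrK subrr rmorph0 mulr0.
have -> : scalext_map phi incl z = \sum_i pure (incl (e i)) (z 0 i) by [].
have := scalext_norm_altv (fun i => incl (e i)) (fun i => z 0 i).
set N := sK _ * _ => N_alt.
have : \sum_i pure (sigma (incl (e i)) * incl (e i) + (q (e i))%:A) (z 0 i ^+ 2)
    \in altv sK.
  by apply: rpred_sum => i _; apply/pure_altv/alternator_quadP.
under eq_bigr => i _ do rewrite pure_tensorDl.
have -> : (\sum_i z 0 i ^+ 2 * phi (q (e i)))%:A =
    \sum_i pure (q (e i))%:A (z 0 i ^+ 2) :> scalext phi A.
  rewrite scaler_suml; apply: eq_bigr => i _.
  by rewrite pure_tensorZl pure_tensorZr mulr1 mulrC.
by rewrite big_split /= => /(rpredD N_alt); rewrite (addrA (_ - _)) subrK.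
Qed.

Lemma scalext_alternator_form (z : scalext phi (subvs_of S)) :
  alternator_form sK (scalext_map phi incl z) = scalext_quad phi q z.
Proof.
apply: alternator_formE; first exact: scalext_one_altv.
exact: scalext_alternator_quad.
Qed.

Lemma alternator_set_scalext_map z : alternator_set sK (scalext_map phi incl z).
Proof.
have charK : 2%N \in [pchar K] by rewrite (fmorph_pchar phi).
exists (scalext_quad phi q z); exists (sK (scalext_map phi incl z) *
    scalext_map phi incl z + (scalext_quad phi q z)%:A).
  exact/AltP/scalext_alternator_quad.
by rewrite addrCA addrr_pchar2 ?addr0 // pchar_lalg.
Qed.

Hypothesis sepK : separable_extension phi.

Lemma separable_extension_root (x : K) :
  exists2 p : {poly F}, separable_poly p & root (map_poly phi p) x.
Proof. by have [p [_ px0 _] p_sep] := sepK x; exists p. Qed.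

Lemma separable_alternator_set x :
  alternator_set sK x -> exists z, scalext_map phi incl z = x.
Proof.
have alg : falgebraic phi.
  move=> y; have [p /separable_poly_neq0 p0 py0] := separable_extension_root y.
  by exists p.
have [n [b [b_free b_alg b_x]]] :=
  finite_subalgebra [seq x 0 i | i <- enum 'I_(\dim {:A})] alg.
have [|v ->] := @fspan_pure_tensor _ _ phi _ x _ b.
  by move=> i; apply/b_x/map_f; rewrite mem_enum.
have b2_free := ffree_sqr charF separable_extension_root b_free b_alg.
move=> /(alternator_set_pure b2_free) v_alt.
exists (\sum_j pure (vsproj S (v j)) (b j)); rewrite linear_sum.
apply: eq_bigr => j _; rewrite /= scalext_map_pure /= vsprojK //.
exact/mem_alternator_space.
Qed.

Lemma scalext_alternator_setE : alternator_set sK =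
  [set scalext_map phi incl z | z in (setT : set (scalext phi (subvs_of S)))].
Proof.
apply/seteqP; split=> [x /separable_alternator_set[z <-]|_ [z _ <-]].
  by exists z.
exact: alternator_set_scalext_map.
Qed.

Lemma scalext_alternator_quad_isometric :
  isometric (@alternator_quad K (scalext phi A) sK) (scalext_quad phi q).
Proof.
have charK : 2%N \in [pchar K] by rewrite (fmorph_pchar phi).
have sK_inv : involution sK.
  split; [exact: linearD|exact: scalext_involutionM|exact: scalext_involutionK].
have SKP := alternator_spaceE charK sK_inv scalext_involution_first_kind.
have projK : cancel (scalext_map phi incl) (scalext_map phi (vsproj S)).
  exact/scalext_mapK/vsvalK.
(* The extended inclusion has the extended [vsproj S] as left inverse; on the alternator space over
   [K] it is also a right inverse, because every element there comes from S(A) (x) K. *)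
have projKV (x : subvs_of (alternator_space sK)) :
    scalext_map phi incl (scalext_map phi (vsproj S) (vsval x)) = vsval x.
  have /SKP/separable_alternator_set[z <-] := subvsP x; by rewrite projK.
have [f fE] : exists f : {linear subvs_of (alternator_space sK) ->
    scalext phi (subvs_of S)}, scalext_map phi (vsproj S) \o vsval = f.
  by apply: linear_funP => c x y /=; rewrite !linearP.
exists f; split; last first.
  by move=> x; rewrite -fE /= -scalext_alternator_form projKV.
exists (vsproj (alternator_space sK) \o scalext_map phi incl) => [x|z].
  by apply: val_inj; rewrite -fE /= projKV vsvalK.
rewrite -fE /= vsprojK ?projK //.
exact/SKP/alternator_set_scalext_map.
Qed.

End ScalarExtensionInvolution.

(** * Orthogonality and the conclusion *)

(** Over any splitting field, conjugating the extended involution by [psi] gives an involutive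
    anti-automorphism [tau] of a matrix algebra. The relation [1 = a - sigma a] is carried along,
    and [alternating_adjoint_form] applies. *)
Lemma symplectic_one_altv (F : fieldType) (A : falgType F)
    (sigma : {linear A -> A}) :
    (forall x y, sigma (x * y) = sigma y * sigma x) -> involutive sigma ->
  1 \in altv sigma -> symplectic sigma.
Proof.
move=> sigmaM sigmaK /AltP[a _ one_alt] L phi n psi [psi' psiK psi'K].
have [tau tauE] : exists tau : {linear 'M[L]_n.+1 -> 'M[L]_n.+1},
    psi \o scalext_map phi sigma \o psi' = tau.
  have psi'_lin : linear psi' by exact: can2_linear psiK psi'K.
  by apply: linear_funP => c X Y /=; rewrite psi'_lin !linearP.
have tauM X Y : tau (X *m Y) = tau Y *m tau X.
  rewrite -tauE /=; have -> : psi' (X *m Y) = psi' X * psi' Y.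
    by apply: (can_inj psiK); rewrite [RHS]rmorphM /= !psi'K.
  by rewrite scalext_involutionM // rmorphM.
have tauK : involutive tau.
  by move=> X; rewrite -tauE /= psiK scalext_involutionK.
have one_tau :
    1%:M = psi (pure_tensor phi a 1) - tau (psi (pure_tensor phi a 1)).
  rewrite -tauE /= psiK scalext_map_pure -linearB /=.
  rewrite -[1%:M](rmorph1 psi) [1 in LHS]/(pure_tensor phi 1 1) -one_alt.
  by congr (psi _); apply/rowP => i; rewrite !mxE linearB rmorphB mulrBl.
have [b [b_alt b_nd b_adj]] := alternating_adjoint_form tauM tauK one_tau.
by exists b; split=> // x u v; rewrite b_adj -tauE /= psiK.
Qed.

Theorem theorem3p5 (F K : fieldType) (phi : {rmorphism F -> K})
    (A : falgType F) (sigma : A -> A)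
    (charF : (2%N \in [pchar F])) (csA : central_simple A)
    (orth_sigma : orthogonal_involution sigma)
    (sepK : separable_extension phi) :
  let sigmaK : scalext phi A -> scalext phi A := scalext_map phi sigma in
  let incl : subvs_of (alternator_space sigma) -> A := vsval in
  alternator_set sigmaK =
    [set scalext_map phi incl z
       | z in (setT : set (scalext phi (subvs_of (alternator_space sigma))))]
  /\ isometric (@alternator_quad K (scalext phi A) sigmaK)
               (scalext_quad phi (@alternator_quad F A sigma)).
Proof.
case: orth_sigma => -[sigmaD sigmaM sigmaK] sigma1 not_sympl.
have [s sE] : exists s : {linear A -> A}, sigma = s.
  (* Linearity comes from [sigma] being additive, reversing products and fixing the scalars
     [c%:A]. *)
  apply: linear_funP => c x y.
  by rewrite sigmaD -[c *: x]mulr_algl sigmaM sigma1 mulr_algr.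
move: sE sigmaD sigmaM sigmaK sigma1 not_sympl => -> _ sM sK s1 not_sympl.
have one_altv : 1 \notin altv s.
  by apply/negP => /(symplectic_one_altv sM sK)/not_sympl.
split; first exact: scalext_alternator_setE.
exact: scalext_alternator_quad_isometric.
Qed.
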